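(* Let $k\in\mathbb{N}$. Each of the languages $L^k$ and $\hat L^k$ can be represented as deterministic parity automata with $2^k$ states (and not less). There exists a deterministic parity automaton for $L^k \cap \hat L^k$ with no more than $2^{4k^2} \cdot k^{2k}$ many states.
   Context: The languages. Let $\Sigma = \{X_1, \ldots, X_k, Y_1, \ldots, Y_k, a_0, \ldots, a_{4k-1}\}$. For $1\le i\le k$ let (as $\omega$-regular expressions) $$L^k_i = ((\Sigma \setminus \{ X_i \}) + X_i (\Sigma \setminus \{ X_i \})^* X_i )^* (a_0 + \ldots + a_{4k-2i+1} )^\omega + \Sigma^* (a_0 + \ldots + a_{4k-2i} )^\omega,$$ $$\hat L^k_i = ((\Sigma \setminus \{ Y_i \}) + Y_i (\Sigma \setminus \{ Y_i \})^* Y_i )^* (a_{2i-2} + \ldots + a_{4k-1} )^\omega + \Sigma^* (a_{2i-1} + \ldots + a_{4k-1} )^\omega.$$ For a falling chain of languages $L_1\supset\cdots\supset L_n$, $\mathcal{L}(L_1,\ldots,L_n)$ is the set of words $w\in\Sigma^\omega$ such that $w\notin L_1$ or the highest $i$ with $w\in L_i$ is even. Set $L^k=\mathcal{L}(L^k_1,\ldots,L^k_k)$ and $\hat L^k=\mathcal{L}(\hat L^k_1,\ldots,\hat L^k_k)$. Automata. A deterministic parity automaton (with transition-based acceptance) is $(Q,\Sigma,\delta,q_0)$ with finite $Q$, initial state $q_0$, and $\delta\subseteq Q\times\Sigma\times Q\times\mathbb{N}$ such that for each $(q,x)\in Q\times\Sigma$ there is exactly one $(q',c)\in Q\times\mathbb{N}$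 with $(q,x,q',c)\in\delta$; $c$ is the color of the transition. A word is accepted if the lowest color occurring infinitely often along its unique run is even. *)

(* Defs.v *)
From mathcomp Require Import all_boot.
From mathcomp Require Import boolp classical_sets.

Set Implicit Arguments.
Unset Strict Implicit.
Unset Printing Implicit Defensive.

Local Open Scope classical_set_scope.

Section OmegaRegular.
Variable S : finType.

(* Finite words are [seq S], infinite words are [nat -> S]. *)
Definition word_app (u : seq S) (v : nat -> S) : nat -> S :=
  fun n => if n < size u then nth (v 0) u n else v (n - size u).

Definition word_factor (w : nat -> S) (m n : nat) : seq S :=
  [seq w i | i <- iota m (n - m)].

Definition re_letters (B : set S) : set (seq S) := [set [:: x] | x in B].

Definition re_cat (A B : set (seq S)) : set (seq S) :=
  [set u ++ v | u in A & v in B].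

Definition re_star (A : set (seq S)) : set (seq S) :=
  [set flatten us | us in [set us | forall u, u \in us -> A u]].

Definition re_catw (A : set (seq S)) (B : set (nat -> S)) : set (nat -> S) :=
  [set word_app u v | u in A & v in B].

(* The increasing positions [p] cut the word into nonempty factors of [A]. *)
Definition re_omega (A : set (seq S)) : set (nat -> S) :=
  [set w | exists p : nat -> nat,
    [/\ p 0 = 0, forall i, p i < p i.+1 &
        forall i, A (word_factor w (p i) (p i.+1))]].

End OmegaRegular.

(* [L i] stands for L_{i+1}; the first disjunct is "w is not in L_1", and is
   vacuously true of the empty chain. *)
Definition chain_lang (S : finType) (n : nat) (L : 'I_n -> set (nat -> S)) :
    set (nat -> S) :=
  [set w | (forall i : 'I_n, i = 0 :> nat -> ~ L i w) \/
           exists i : 'I_n, [/\ L i w, forall j : 'I_n, i < j -> ~ L j w &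
                                ~~ odd i.+1]].

Definition letter (k : nat) := ('I_k + 'I_k + 'I_(4 * k))%type.

(* [letX i] and [letY i] are the letters X_{i+1} and Y_{i+1}; [leta j] is a_j. *)
Definition letX k (i : 'I_k) : letter k := inl (inl i).
Definition letY k (i : 'I_k) : letter k := inl (inr i).
Definition leta k (j : 'I_(4 * k)) : letter k := inr j.

Definition all_words k : set (seq (letter k)) := re_star (re_letters setT).

(* ((Sigma \ {x}) + x (Sigma \ {x})^* x)^* *)
Definition even_words k (x : letter k) : set (seq (letter k)) :=
  re_star (re_letters [set~ x] `|`
    re_cat (re_cat (re_letters [set x]) (re_star (re_letters [set~ x])))
           (re_letters [set x])).

(* a_lo + ... + a_hi *)
Definition a_range k (lo hi : nat) : set (seq (letter k)) :=
  re_letters [set leta j | j in [set j : 'I_(4 * k) | lo <= j <= hi]].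

(* In the next two definitions the ordinal [i0] gives the index [i = i0 + 1],
   so that 1 <= i <= k and none of the subtractions truncates. *)
Definition Lki k (i0 : 'I_k) : set (nat -> letter k) :=
  let i := i0.+1 in
  re_catw (even_words (letX i0)) (re_omega (@a_range k 0 (4 * k - 2 * i + 1))) `|`
  re_catw (@all_words k) (re_omega (@a_range k 0 (4 * k - 2 * i))).

Definition Lhatki k (i0 : 'I_k) : set (nat -> letter k) :=
  let i := i0.+1 in
  re_catw (even_words (letY i0))
          (re_omega (@a_range k (2 * i - 2) (4 * k - 1))) `|`
  re_catw (@all_words k) (re_omega (@a_range k (2 * i - 1) (4 * k - 1))).

Definition Lk (k : nat) : set (nat -> letter k) := chain_lang (@Lki k).
Definition Lhatk (k : nat) : set (nat -> letter k) := chain_lang (@Lhatki k).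
Arguments Lk : clear implicits.
Arguments Lhatk : clear implicits.

Record dpa (S : finType) := DPA {
  state : finType;
  trans : set (state * S * state * nat);
  init : state;
  trans_det : forall (q : state) (x : S),
    exists! p : state * nat, trans (q, x, p.1, p.2) }.

Definition is_run (S : finType) (A : dpa S) (w : nat -> S)
    (r : nat -> state A) (c : nat -> nat) : Prop :=
  r 0 = init A /\ forall n, trans (r n, w n, r n.+1, c n).

Definition inf_often (c : nat -> nat) (m : nat) : Prop :=
  forall N, exists2 n, N <= n & c n = m.

Definition dpa_lang (S : finType) (A : dpa S) : set (nat -> S) :=
  [set w | exists (r : nat -> state A) (c : nat -> nat) (m : nat),
    [/\ is_run w r c, inf_often c m,
        forall m', inf_often c m' -> m <= m' & ~~ odd m]].

(* Main.v *)
Require Import Defs.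
From mathcomp Require Import all_boot zify.
From mathcomp Require Import boolp classical_sets.

(** A word lies in [L_i] iff from some point on every letter is [a_j] with
    [j <= 4k - 2i], or [j = 4k - 2i + 1] while the number of [X_i] read so far
    is even.  So the automaton that stores the [k] parities recognizes all the
    [L_i] as co-Buchi languages.  Along a falling chain, the number of
    conditions met at a step is a min-parity colour for the chain language,
    because its limit inferior is the highest [i] with [w \in L_i].
    Conversely, two parity vectors that differ at [i] are separated by the
    suffix [a_(4k-2i+1)^omega], on which the highest index is [i] or [i - 1].
    The same holds for the hatted languages, with [Y_i] and [a_(2i-2)^omega].

    The conjunction of two min-parity conditions with colours at most [k] is a
    Streett condition with [2k] pairs: whenever the odd colour [i + 1] recurs,
    so does some colour [<= i].  A Streett condition turns into a parity
    condition by storing for each pair how many pairs have responded more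
    recently, which costs a factor [(2k)^(2k)]; and
    [4^k (2k)^(2k) <= 2^(4k^2) k^(2k)]. *)

Set Implicit Arguments.
Unset Strict Implicit.
Unset Printing Implicit Defensive.

Local Open Scope classical_set_scope.

(** * Recurrence, limits inferior and parity conditions *)

Definition infinitely (P : nat -> Prop) : Prop :=
  forall N, exists2 n, N <= n & P n.

Lemma not_infinitely (P : nat -> Prop) :
  ~ infinitely P -> exists N, forall n, N <= n -> ~ P n.
Proof.
move=> nP; apply: contrapT => nE; apply: nP => N.
apply: contrapT => nN; apply: nE; exists N => n le_Nn Pn.
by apply: nN; exists n.
Qed.

(** Pigeonhole: otherwise every [t] has a bound past which [P t] fails, and the maximum of these
    finitely many bounds contradicts recurrence. *)
Lemma infinitely_exists (T : finType) (P : T -> nat -> Prop) :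
  infinitely (fun n => exists t, P t n) -> exists t, infinitely (P t).
Proof.
move=> infP; apply: contrapT => nP.
have /choice[N hN] : forall t, exists N, forall n, N <= n -> ~ P t n.
  by move=> t; apply: not_infinitely => h; apply: nP; exists t.
have [n le_n [t Ptn]] := infP (\max_t N t).
by apply: (hN t n) => //; apply: leq_trans le_n; apply: (leq_bigmax t).
Qed.

Definition even_parity (c : nat -> nat) : Prop :=
  exists m, [/\ inf_often c m, forall m', inf_often c m' -> m <= m' & ~~ odd m].

Definition is_liminf (c : nat -> nat) (d : nat) : Prop :=
  inf_often c d /\ exists N, forall n, N <= n -> d <= c n.

Lemma bounded_liminf (c : nat -> nat) (b : nat) :
  (forall n, c n <= b) -> exists d, is_liminf c d.
Proof.
move=> cb.
have [i0 infi0] : exists i : 'I_b.+1, infinitely (fun n => c n = i).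
  apply: infinitely_exists => N; exists N => //.
  by exists (Ordinal (cb N : c N < b.+1)).
have exd : exists d, `[< inf_often c d >] by exists i0; apply/asboolP.
case: (ex_minnP exd) => d /asboolP infd mind; exists d; split=> //.
have /choice[N hN] : forall i : 'I_d, exists N, forall n, N <= n -> c n <> i.
  move=> i; apply: not_infinitely => h.
  have /mind : `[< inf_often c i >] by apply/asboolP.
  by rewrite leqNgt ltn_ord.
exists (\max_i N i) => n le_n; rewrite leqNgt; apply/negP => lt_cd.
apply: (hN (Ordinal lt_cd) n) => //; apply: leq_trans le_n.
exact: (leq_bigmax (Ordinal lt_cd)).
Qed.

Lemma even_parity_liminf (c : nat -> nat) (d : nat) :
  is_liminf c d -> even_parity c <-> ~~ odd d.
Proof.
move=> [infd [N hN]].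
have mind m : inf_often c m -> d <= m.
  by move=> /(_ N)[n le_n <-]; apply: hN.
split=> [[m [infm minm evm]]|evd]; last by exists d.
by have -> : d = m by apply/eqP; rewrite eqn_leq mind ?minm.
Qed.

Lemma liminf_gt (c : nat -> nat) (d i : nat) : is_liminf c d ->
  (exists N, forall n, N <= n -> i < c n) <-> i < d.
Proof.
move=> [infd [N hN]]; split=> [[M hM]|lt_id].
  by have [n le_n <-] := infd M; apply: hM.
by exists N => n /hN; apply: leq_trans.
Qed.

Lemma liminf_cst (d : nat) : is_liminf (fun=> d) d.
Proof. by split=> [N|]; [exists N | exists 0]. Qed.

Lemma even_parity_shift (c : nat -> nat) (N : nat) :
  even_parity (fun n => c (N + n)) <-> even_parity c.
Proof.
suff inf_shift m : inf_often (fun n => c (N + n)) m <-> inf_often c m.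
  by split=> -[m [infm minm evm]]; exists m; split=> // [|m' infm'];
    try apply: minm; apply/inf_shift.
split=> infm K.
  by have [n le_n cn] := infm K; exists (N + n); first lia.
have [n le_n cn] := infm (N + K).
by exists (n - N); [lia | rewrite subnKC //; lia].
Qed.

(** If the limit inferior [d] is even and the odd colour [i.+1] recurs, then [d <= i] by parity, and
    [d] recurs. If [d] is odd, the pair at [d - 1] fails, since values below [d] eventually stop. *)
Lemma even_parity_streett (c : nat -> nat) (k : nat) :
  (forall n, c n <= k) ->
  even_parity c <->
  forall i : 'I_k, ~~ odd i ->
    infinitely (fun n => c n = i.+1) -> infinitely (fun n => c n <= i).
Proof.
move=> ck; have [d limd] := bounded_liminf ck.
rewrite (even_parity_liminf limd); have [infd [N hN]] := limd.
split=> [evd i evi infi M|st].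
  have [n le_n cn] := infd M; exists n => //; rewrite {}cn.
  have [n' /hN] := infi N.
  move=> + cn'; rewrite cn' leq_eqVlt => /predU1P[ed|//].
  by rewrite ed /= evi in evd.
apply/negP => oddd.
have le_dk : d <= k by have [n _ <-] := infd 0.
case: d => [|d] in limd infd hN oddd le_dk * => //.
have [n le_n] := st (Ordinal le_dk) oddd infd N.
by rewrite leqNgt hN.
Qed.

(** Membership in [L i] amounts to [i < d] for the limit inferior [d] of the colours, so [d] is the
    highest index in one-based numbering, and 0 if there is none. *)
Lemma chain_lang_parity (S : finType) (n : nat) (L : 'I_n -> set (nat -> S))
    (w : nat -> S) (c : nat -> nat) :
    (forall m, c m <= n) ->
    (forall i, L i w <-> exists N, forall m, N <= m -> i < c m) ->
  chain_lang L w <-> even_parity c.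
Proof.
move=> cn LE; have [d limd] := bounded_liminf cn.
rewrite (even_parity_liminf limd).
have {}LE i : L i w <-> i < d by rewrite LE; apply: liminf_gt.
have le_dn : d <= n by case: limd => /(_ 0)[m _ <-].
split=> [[L0|[i [/LE lt_id maxi evi]]]|evd].
- case: d => [|d] in limd LE le_dn * => //.
  by case: (L0 (Ordinal (leq_ltn_trans (leq0n d) le_dn)) erefl); apply/LE.
- case: (ltngtP d i.+1) => [|lt_id'|->//]; first by rewrite ltnNge lt_id.
  have lt_in := leq_trans lt_id' le_dn.
  by case: (maxi (Ordinal lt_in) (ltnSn i)); apply/LE.
- case: d => [|d] in limd LE le_dn evd *.
    by left=> i _ /LE; rewrite ltn0.
  right; exists (Ordinal le_dn); split=> //; first exact/LE.
  by move=> j lt_dj /LE; rewrite ltnS leqNgt lt_dj.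
Qed.

(** * Deterministic runs and lower bounds on the number of states *)

Section Runs.
Variables (S Q : finType) (step : Q -> S -> Q).

Fixpoint run (q : Q) (w : nat -> S) (n : nat) : Q :=
  if n is m.+1 then step (run q w m) (w m) else q.

Lemma run_word_app (q : Q) (u : seq S) (v : nat -> S) (n : nat) :
  run q (word_app u v) (size u + n) = run (foldl step q u) v n.
Proof.
elim: n => [|n IHn]; last first.
  rewrite addnS /= IHn; congr step.
  by rewrite /word_app ltnNge leq_addr /= addKn.
rewrite addn0 /=; suff run_take m : m <= size u ->
    run q (word_app u v) m = foldl step q (take m u).
  by rewrite run_take ?take_size.
elim: m => [_|m IHm lt_m]; first by rewrite take0.
rewrite /= IHm; last exact: ltnW.
by rewrite (take_nth (v 0) lt_m) foldl_rcons /word_app lt_m.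
Qed.

Variables (q0 : Q) (col : Q -> S -> nat).

Definition colors (w : nat -> S) (n : nat) : nat := col (run q0 w n) (w n).

Definition dpa_trans : set (Q * S * Q * nat) :=
  [set t | t.1.2 = step t.1.1.1 t.1.1.2 /\ t.2 = col t.1.1.1 t.1.1.2].

Lemma dpa_trans_det (q : Q) (x : S) :
  exists! p : Q * nat, dpa_trans (q, x, p.1, p.2).
Proof.
by exists (step q x, col q x); split=> // -[q' c] [/= -> ->].
Qed.

Definition dpa_of : dpa S := DPA q0 dpa_trans_det.

End Runs.

Lemma dpa_langE (S : finType) (A : dpa S) (step : state A -> S -> state A)
    (col : state A -> S -> nat) (w : nat -> S) :
    (forall q x q' c, trans (q, x, q', c) <-> q' = step q x /\ c = col q x) ->
  dpa_lang A w <-> even_parity (colors step (init A) col w).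
Proof.
move=> transE; split=> [[r [c [m [[r0 rS] infm minm evm]]]]|[m [infm minm evm]]].
  have rE n : r n = run step (init A) w n.
    by elim: n => [//|n IHn]; have /transE[-> _] := rS n; rewrite IHn.
  have cE : c = colors step (init A) col w.
    by apply/funext => n; have /transE[_ ->] := rS n; rewrite rE.
  by rewrite cE in infm minm; exists m.
exists (run step (init A) w), (colors step (init A) col w), m; split=> //.
by split=> // n; apply/transE.
Qed.

Lemma dpa_of_langE (S Q : finType) (step : Q -> S -> Q) (q0 : Q)
    (col : Q -> S -> nat) (w : nat -> S) :
  dpa_lang (dpa_of step q0 col) w <-> even_parity (colors step q0 col w).
Proof. exact: dpa_langE. Qed.

Lemma dpa_functional (S : finType) (A : dpa S) :
  exists (step : state A -> S -> state A) (col : state A -> S -> nat),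
    forall q x q' c, trans (q, x, q', c) <-> q' = step q x /\ c = col q x.
Proof.
have /choice[f hf] : forall qx : state A * S, exists p : state A * nat,
    unique (fun p => trans (qx.1, qx.2, p.1, p.2)) p.
  by move=> [q x]; apply: trans_det.
exists (fun q x => (f (q, x)).1), (fun q x => (f (q, x)).2) => q x q' c.
have [/= tf uf] := hf (q, x).
by split=> [/(uf (q', c)) ->|[-> ->]].
Qed.

(** If two prefixes reach the same state, the colours read after them coincide, and a parity
    condition ignores finite prefixes. Hence separated prefixes reach distinct states. *)
Lemma nerode_bound (S T : finType) (A : dpa S) (u : T -> seq S) :
    (forall s t, s != t -> exists v : nat -> S,
       ~ (dpa_lang A (word_app (u s) v) <-> dpa_lang A (word_app (u t) v))) ->
  #|T| <= #|state A|.
Proof.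
move=> sep; have [step [col transE]] := dpa_functional A.
apply: (@leq_card _ _ (fun t => foldl step (init A) (u t))) => s t eq_st.
apply/eqP; apply/negPn/negP => /sep[v]; apply.
have langE r : dpa_lang A (word_app (u r) v) <->
    even_parity (colors step (foldl step (init A) (u r)) col v).
  rewrite (dpa_langE _ transE) -(even_parity_shift _ (size (u r))).
  suff -> : (fun n => colors step (init A) col (word_app (u r) v)
               (size (u r) + n))
          = colors step (foldl step (init A) (u r)) col v by [].
  apply/funext => n; rewrite /colors run_word_app.
  by rewrite /word_app ltnNge leq_addr /= addKn.
by rewrite !langE eq_st.
Qed.

(** * From Streett to parity conditions by ranking the pairs *)

Section Ranks.
Variable P : finType.

(* The rank of [p] is the number of indices that have responded more recently
   than [p]; indices responding at the same step are tied. *)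
Definition next_rank (rho : P -> nat) (R : pred P) (p : P) : nat :=
  if R p then 0 else #|[pred q | R q || (rho q < rho p)]|.

Lemma next_rank_lt (rho : P -> nat) (R : pred P) (p : P) :
  next_rank rho R p < #|P|.
Proof.
rewrite /next_rank; case: ifP => [_|Rp]; first by apply/card_gt0P; exists p.
apply: proper_card; apply/fintype.properP; split; first exact/fintype.subsetP.
by exists p; rewrite // inE Rp ltnn.
Qed.

Lemma next_rank_mono (rho : P -> nat) (R : pred P) (p q : P) :
  ~~ R p -> R q || (rho q < rho p) -> next_rank rho R q < next_rank rho R p.
Proof.
rewrite /next_rank => /negbTE-> qp; case: ifP => Rq.
  by apply/card_gt0P; exists q.
rewrite Rq /= in qp; apply: proper_card; apply/fintype.properP; split.
  apply/fintype.subsetP => r; rewrite !inE => /orP[->//|lt_rq].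
  by rewrite (ltn_trans lt_rq qp) orbT.
by exists q; rewrite !inE ?qp ?orbT // Rq ltnn.
Qed.

(* Eventually the indices that respond only finitely often have the largest
   ranks, and each index that keeps responding does so at ranks at least those
   of its preceding requests.  So a request is harmless iff responses at its rank or
   higher recur. *)
Definition score (req resp : pred P) (rho : P -> nat) (p : P) : nat :=
  if resp p then (rho p).*2.+2 else if req p then (rho p).*2.+1 else 0.

(** The highest recurring score has to decide, but parity looks at the lowest colour. Subtracting
    from an even bound on the scores ([max_score_le]) reverses the order and keeps the parity. *)
Definition rank_color (req resp : pred P) (rho : P -> nat) : nat :=
  (#|P|).*2 - \max_p score req resp rho p.

Variables (req resp : nat -> pred P) (rho : nat -> P -> nat).
Hypothesis rho0 : forall p, rho 0 p = 0.
Hypothesis rhoS : forall n p, rho n.+1 p = next_rank (rho n) (resp n) p.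

(** Every index counted in the new rank of [p] ends up strictly below [p], by [next_rank_mono]. This
    yields [rho_monoS]: without a response a rank never drops. *)
Lemma rho_le_card n p : rho n p <= #|[pred q | rho n q < rho n p]|.
Proof.
case: n p => [|n] p; first by rewrite rho0.
rewrite rhoS {1}/next_rank; case: ifP => Rp //.
apply: subset_leq_card; apply/fintype.subsetP => q; rewrite !inE => qp.
by rewrite !rhoS next_rank_mono ?Rp.
Qed.

Lemma rho_monoS n p : ~~ resp n p -> rho n p <= rho n.+1 p.
Proof.
move=> nR; rewrite rhoS /next_rank (negbTE nR).
apply: leq_trans (rho_le_card n p) _; apply: subset_leq_card.
by apply/fintype.subsetP => q; rewrite !inE => ->; rewrite orbT.
Qed.

Lemma rho_mono m n p : m <= n ->
  (forall i, m <= i -> i < n -> ~~ resp i p) -> rho m p <= rho n p.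
Proof.
move=> /subnKC <-; elim: (n - m) => [|j IHj] nR; first by rewrite addn0.
rewrite addnS; apply: leq_trans (IHj _) (rho_monoS _) => [i le_i lt_i|].
  by apply: nR => //; lia.
by apply: nR; lia.
Qed.

Let scoren n := score (req n) (resp n) (rho n).

Lemma rho_lt n p : rho n p < #|P|.
Proof.
case: n => [|n]; rewrite ?rhoS ?next_rank_lt // rho0.
by apply/card_gt0P; exists p.
Qed.

Lemma max_score_le n : \max_p scoren n p <= (#|P|).*2.
Proof.
apply/bigmax_leqP => p _; rewrite /scoren /score; have := rho_lt n p.
by case: ifP => _; [|case: ifP => _]; lia.
Qed.

Lemma rank_color_streett :
  even_parity (fun n => rank_color (req n) (resp n) (rho n)) <->
  forall p, infinitely (fun n => req n p) -> infinitely (fun n => resp n p).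
Proof.
have [d limd] :=
  bounded_liminf (fun n => leq_subr (\max_p scoren n p) (#|P|).*2).
rewrite (even_parity_liminf limd); have [infd [N hN]] := limd.
have le_d : d <= (#|P|).*2 by have [n _ <-] := infd 0; apply: leq_subr.
(* [s] is the limit superior of the maximal score and has the parity of [d]. *)
pose s := (#|P|).*2 - d.
have odd_s : odd d = odd s by rewrite /s oddB // odd_double; case: odd.
have le_s n p : N <= n -> scoren n p <= s.
  move=> /hN h; apply: leq_trans (leq_bigmax p) _.
  by have := max_score_le n; rewrite /s; lia.
have inf_s : 0 < s -> exists p, infinitely (fun n => scoren n p = s).
  move=> s_gt0; apply: infinitely_exists => M.
  have [n le_n] := infd M; have := max_score_le n => le_m cn; exists n => //.
  have max_s : \max_p scoren n p = s by rewrite /s -cn /rank_color; lia.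
  have : 0 < #|P| by move: s_gt0; rewrite /s; lia.
  by move=> /(eq_bigmax (scoren n))[p pE]; exists p; rewrite -pE.
rewrite odd_s; split=> [evs p infp|st].
(* Suppose [p] keeps requesting but stops responding. As [s] is even, it is attained infinitely
   often by responses of some [q]. After one of them [q] stays ranked strictly below [p]; at the
   next, [s] is twice the rank of [q] plus 2, and a later request of [p] scores more than that. *)
- apply: contrapT => /not_infinitely[M hM].
  have s_gt0 : 0 < s.
    have [n le_n rn] := infp (maxn M N).
    have := le_s n p; rewrite /scoren /score rn; case: ifP => _ h.
      by apply: leq_trans (h _); lia.
    by apply: leq_trans (h _); lia.
  have [q infq] := inf_s s_gt0.
  have scoreq n : scoren n q = s -> resp n q /\ s = (rho n q).*2.+2.
    rewrite /scoren /score; case: ifP => [_ <-//|_]; case: ifP => _ sE; last lia.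
    by move: evs; rewrite -sE /= odd_double.
  have nresp n : maxn M N <= n -> ~~ resp n p.
    by move=> le_n; apply/negP => /hM; apply; lia.
  have [n1 le_n1 /scoreq[R1 s1]] := infq (maxn M N).
  have lt_qp j : rho (n1.+1 + j) q < rho (n1.+1 + j) p.
    elim: j => [|j IHj]; rewrite ?addn0 ?addnS rhoS [in X in _ < X]rhoS.
      by rewrite next_rank_mono ?R1 // nresp.
    by rewrite next_rank_mono ?IHj ?orbT // nresp //; lia.
  have [n2 le_n2 /scoreq[_ s2]] := infq n1.+1.
  have := lt_qp (n2 - n1.+1); rewrite subnKC // => lt2.
  have [n3 le_n3 r3] := infp n2.
  have le23 : rho n2 p <= rho n3 p.
    by apply: rho_mono => // i le_i _; apply: nresp; lia.
  have := le_s n3 p; rewrite /scoren /score r3 (negbTE (nresp n3 _)); lia.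
(* As [s] is odd, requests of some [p] attain it infinitely often. The first response of [p] from
   then on comes at no lower rank, so it scores more than [s]. *)
- apply/negP => odds; have [p infp] := inf_s (odd_gt0 odds).
  have scorep n : scoren n p = s -> req n p /\ s = (rho n p).*2.+1.
    rewrite /scoren /score; case: ifP => [_ sE|_].
      by move: odds; rewrite -sE /= odd_double.
    by case: ifP => [//|_ sE]; rewrite -sE in odds.
  have infr : infinitely (fun n => req n p).
    by move=> M; have [n le_n /scorep[rn _]] := infp M; exists n.
  have [n le_n /scorep[_ sE]] := infp N.
  have [m0 le_m0 R0] := st p infr n.
  have exR : exists m, (n <= m) && resp m p by exists m0; rewrite le_m0.
  case: (ex_minnP exR) => m /andP[le_nm Rm] minm.
  have le_rho : rho n p <= rho m p.
    apply: rho_mono => // i le_i lt_im; apply/negP => Ri.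
    by have := minm i; rewrite le_i Ri leqNgt lt_im => /(_ isT).
  by have := le_s m p; rewrite /scoren /score Rm; lia.
Qed.

End Ranks.

(** * Conjunction of two parity conditions *)

Lemma conj_parity_dpa (S Q : finType) (step : Q -> S -> Q) (q0 : Q)
    (c1 c2 : Q -> S -> nat) (k : nat) :
    (forall q x, c1 q x <= k) -> (forall q x, c2 q x <= k) ->
  exists2 A : dpa S, #|state A| = #|Q| * (2 * k) ^ (2 * k) &
    forall w, dpa_lang A w <-> even_parity (colors step q0 c1 w) /\
                               even_parity (colors step q0 c2 w).
Proof.
(* A conjunction of Streett conditions is the Streett condition on the disjoint union of their
   pairs. *)
move=> c1k c2k; pose P : finType := ('I_k + 'I_k)%type.
pose req q x : pred P := fun p => match p with
  | inl i => ~~ odd i && (c1 q x == i.+1)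
  | inr i => ~~ odd i && (c2 q x == i.+1)
  end.
pose resp q x : pred P := fun p => match p with
  | inl i => c1 q x <= i
  | inr i => c2 q x <= i
  end.
pose upd (rho : P -> nat) (R : pred P) : {ffun P -> 'I_#|P|} :=
  [ffun p => Ordinal (next_rank_lt rho R p)].
pose nat_of (rho : {ffun P -> 'I_#|P|}) p : nat := rho p.
pose step' (t : Q * {ffun P -> 'I_#|P|}) x :=
  (step t.1 x, upd (nat_of t.2) (resp t.1 x)).
pose col t x := rank_color (req t.1 x) (resp t.1 x) (nat_of t.2).
(* Letting every pair respond at once produces the all-zero ranking, also when [P] is empty. *)
exists (dpa_of step' (q0, upd (fun=> 0) predT) col) => [|w].
  by rewrite card_prod card_ffun card_ord card_sum !card_ord addnn -mul2n.
rewrite dpa_of_langE.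
pose r := run step' (q0, upd (fun=> 0) predT) w.
have r1 n : (r n).1 = run step q0 w n.
  by elim: n => //= n IHn; rewrite -IHn.
have -> : colors step' (q0, upd (fun=> 0) predT) col w =
    fun n => rank_color (req (run step q0 w n) (w n))
                        (resp (run step q0 w n) (w n)) (nat_of (r n).2).
  by apply/funext => n; rewrite /colors /col -/r r1.
rewrite rank_color_streett => [|p|n p]; last 2 first.
- by rewrite /nat_of /= ffunE.
- by rewrite /nat_of /= ffunE /= -/r r1.
rewrite (even_parity_streett (k := k)) ?(even_parity_streett (k := k)) => //.
split=> [st|[st1 st2] [i|i] infr].
- split=> i evi infi.
    by apply: (st (inl i)) => M; have [n le_n cn] := infi M; exists n => //;
      rewrite /req evi; apply/eqP.
  by apply: (st (inr i)) => M; have [n le_n cn] := infi M; exists n => //;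
    rewrite /req evi; apply/eqP.
- apply: st1; first by have [n _ /andP[]] := infr 0.
  by move=> M; have [n le_n /andP[_ /eqP]] := infr M; exists n.
- apply: st2; first by have [n _ /andP[]] := infr 0.
  by move=> M; have [n le_n /andP[_ /eqP]] := infr M; exists n.
- by move=> n; apply: c2k.
- by move=> n; apply: c1k.
Qed.

(** * Letterwise reading of the regular expressions *)

Section Words.
Variable S : finType.

Lemma omega_lettersE (B : set S) (v : nat -> S) :
  re_omega (re_letters B) v <-> forall n, B (v n).
Proof.
split=> [[p [p0 pS pA]] n|Bv]; last first.
  exists id; split=> // i; rewrite /word_factor subSnn /=.
  by exists (v i).
(* Factors of length one force a cut at every position. *)
have pE i : p i = i.
  elim: i => // i IHi; have [y _ yE] := pA i.
  have /(congr1 size) := yE; rewrite /word_factor size_map size_iota /= IHi.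
  by have := pS i; rewrite IHi; lia.
by have [y By] := pA n; rewrite !pE /word_factor subSnn => -[<-].
Qed.

Lemma catw_omegaE (U : set (seq S)) (B : set S) (w : nat -> S) :
  re_catw U (re_omega (re_letters B)) w <->
  exists N, U (mkseq w N) /\ forall n, N <= n -> B (w n).
Proof.
split=> [[u Uu [v /omega_lettersE Bv <-]]|[N [UN BN]]].
  exists (size u); split=> [|n le_n]; last by rewrite /word_app ltnNge le_n; apply: Bv.
  suff -> : mkseq (word_app u v) (size u) = u by [].
  apply: (@eq_from_nth _ (v 0)); rewrite size_mkseq // => i lt_i.
  by rewrite nth_mkseq // /word_app lt_i.
exists (mkseq w N) => //; exists (fun n => w (n + N)).
  by apply/omega_lettersE => n; apply: BN; rewrite leq_addl.
apply/funext => n; rewrite /word_app size_mkseq; case: ltnP => [lt_n|le_n].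
  by rewrite nth_mkseq.
by rewrite subnK.
Qed.

Lemma star_cat (A : set (seq S)) (u v : seq S) :
  A u -> re_star A v -> re_star A (u ++ v).
Proof.
move=> Au [us Aus <-]; exists (u :: us) => // u'.
by rewrite inE => /predU1P[->|/Aus].
Qed.

Lemma star_nil (A : set (seq S)) : re_star A [::].
Proof. by exists [::]. Qed.

Lemma star_lettersE (B : set S) (u : seq S) :
  re_star (re_letters B) u <-> forall y, y \in u -> B y.
Proof.
split=> [[us Aus <-] y /flattenP[s /Aus[z Bz <-]]|].
  by rewrite inE => /eqP->.
elim: u => [|y u IHu] Bu; first exact: star_nil.
apply: (@star_cat _ [:: y]); first by exists y => //; apply: Bu; rewrite mem_head.
by apply: IHu => z zu; apply: Bu; rewrite inE zu orbT.
Qed.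

(** The expression [even_words] over an arbitrary alphabet; on [letter k] the two are convertible,
    which [LkE] and [LhatkE] rely on. *)
Definition even_occ (x : S) : set (seq S) :=
  re_star (re_letters [set~ x] `|`
    re_cat (re_cat (re_letters [set x]) (re_star (re_letters [set~ x])))
           (re_letters [set x])).

Lemma even_occE (x : S) (u : seq S) : even_occ x u <-> ~~ odd (count_mem x u).
Proof.
have count0 s : (forall y, y \in s -> y <> x) -> count_mem x s = 0.
  by move=> ns; apply/count_memPn/negP => /ns.
split=> [[us Aus <-]|].
  elim: us Aus => //= s us IHus Aus; rewrite count_cat oddD.
  rewrite (negbTE (IHus _)) => [|t tus]; last by apply: Aus; rewrite inE tus orbT.
  rewrite addbF; have [[y yx <-]|] := Aus s (mem_head _ _).
    by rewrite count0 // => z; rewrite inE => /eqP->.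
  move=> [_ [_ [_ -> <-] [s' /star_lettersE ns' <-]] [_ [_ -> <-] <-]].
  by rewrite !count_cat /= count0 // eqxx.
(* Strong induction on the length, because a factor that starts with [x] can be arbitrarily long. *)
elim: (size u).+1 {-2}u (ltnSn (size u)) => {u} // m IHm [|y u] /=.
  by move=> _ _; apply: star_nil.
rewrite ltnS => lt_u; case: eqVneq => [->|yx] /= evu; last first.
  apply: (@star_cat _ [:: y]); last exact: IHm.
  by left; exists y => //; apply/eqP.
(* After a leading [x] an odd number of [x] remains; the first of them closes the factor. *)
have xu : x \in u by rewrite -has_pred1 has_count; case: count evu.
have := drop_index xu; have := cat_take_drop (index x u) u.
set u1 := take _ _; set u2 := drop _.+1 _ => uE duE.
have nx1 : x \notin u1 by rewrite in_take // ltnn.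
rewrite -{}uE {}duE in lt_u evu *.
rewrite -cat_rcons -cats1 -cat_cons; apply: star_cat.
  right; exists (x :: u1); last by exists [:: x] => //; exists x.
  exists [:: x]; first by exists x.
  exists u1 => //; apply/star_lettersE => z zu1 zx.
  by rewrite -zx zu1 in nx1.
apply: IHm; first by move: lt_u; rewrite size_cat /=; lia.
by move: evu; rewrite count_cat /= eqxx (count_memPn nx1) add0n /= negbK.
Qed.

End Words.

(** * Falling chains governed by parities of letter counts *)

Section ParityFamily.
Variables (S : finType) (k : nat) (x : 'I_k -> S) (D1 D0 : 'I_k -> pred S).
Hypothesis D01 : forall i, subpred (D0 i) (D1 i).
Hypothesis D10 : forall i j : 'I_k, i < j -> subpred (D1 j) (D0 i).
Hypothesis D1x : forall i j, ~~ D1 i (x j).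

(** The common shape of the plain and the hatted languages, so that one argument serves both. *)
Definition family_lang (i : 'I_k) : set (nat -> S) :=
  re_catw (even_occ (x i)) (re_omega (re_letters [set y | D1 i y])) `|`
  re_catw (re_star (re_letters setT)) (re_omega (re_letters [set y | D0 i y])).

Definition parities : finType := {ffun 'I_k -> bool}.

Definition flip (q : parities) (y : S) : parities :=
  [ffun i => q i (+) (y == x i)].

Definition good (q : parities) (y : S) (i : 'I_k) : bool :=
  D0 i y || D1 i y && ~~ q i.

Definition level (q : parities) (y : S) : nat := \max_(i | good q y i) i.+1.

Definition parities0 : parities := [ffun=> false].

Lemma level_le q y : level q y <= k.
Proof. by apply/bigmax_leqP => i _. Qed.

(** Goodness is downward closed in the index: by [D10] a letter of [D1 j] lies in [D0 i] for all
    [i < j], whatever the parities. So the highest good index is also the number of good indices. *)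
Lemma level_gt q y (i : 'I_k) : (i < level q y) = good q y i.
Proof.
apply/idP/idP => [|gi]; last exact: leq_bigmax_cond gi.
apply: contraLR => gi; rewrite -leqNgt; apply/bigmax_leqP => j gj.
rewrite ltnNge; apply/negP; rewrite leq_eqVlt => /predU1P[/val_inj ij|lt_ij].
  by rewrite ij gj in gi.
move: gi; rewrite /good (D10 lt_ij) //.
by case/orP: gj => [/D01//|/andP[]].
Qed.

(** A letter in [D1 i] but not in [D0 i] makes all indices below [i] good and none above, so only
    the parity at [i] matters. *)
Lemma level_separating q y (i : 'I_k) :
  D1 i y -> ~~ D0 i y -> level q y = i + ~~ q i.
Proof.
move=> D1y D0y; apply/eqP; rewrite eqn_leq; apply/andP; split.
  apply/bigmax_leqP => j; rewrite /good.
  case: (ltngtP i j) => [lt_ij|lt_ji _|/val_inj<-]; last first.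
  - by rewrite (negbTE D0y) D1y /= => ->; rewrite addn1.
  - exact: leq_trans lt_ji (leq_addr _ _).
  - move=> gj; case/negP: D0y; apply: (D10 lt_ij).
    by case/orP: gj => [/D01//|/andP[]].
case qi: (q i); last by rewrite addn1 level_gt /good D1y qi orbT.
(* At odd parity the level [i] is attained by the predecessor of [i]; for [i = 0] the bound is
   trivial. *)
rewrite addn0; case: i => [[//|i] lt_ik] /= in D1y D0y qi *.
by rewrite (level_gt q y (Ordinal (ltnW lt_ik))) /good (D10 _ D1y).
Qed.

Lemma run_flip (w : nat -> S) n i :
  run flip parities0 w n i = odd (count_mem (x i) (mkseq w n)).
Proof.
elim: n => [|n IHn]; first by rewrite ffunE.
by rewrite ffunE IHn mkseqS -cats1 count_cat /= addn0 oddD oddb.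
Qed.

Lemma run_const (w : nat -> S) N i :
    (forall n, N <= n -> w n != x i) ->
  forall n, N <= n -> run flip parities0 w n i = run flip parities0 w N i.
Proof.
move=> wx n /subnKC <-; elim: (n - N) => [|m IHm]; first by rewrite addn0.
by rewrite addnS ffunE IHm (negbTE (wx _ _)) ?leq_addr // addbF.
Qed.

Lemma family_langE (w : nat -> S) (i : 'I_k) :
  family_lang i w <->
  exists N, forall n, N <= n -> i < colors flip parities0 level w n.
Proof.
have neqx y : D1 i y -> y != x i by apply: contraL => /eqP->.
split=> [[]|[N hN]].
- move=> /catw_omegaE[N [/even_occE evN wD1]]; exists N => n le_n.
  rewrite /colors level_gt /good wD1 // (@run_const _ N) //; last first.
    by move=> m /wD1/neqx.
  by rewrite run_flip evN orbT.
- move=> /catw_omegaE[N [_ wD0]]; exists N => n le_n.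
  by rewrite /colors level_gt /good wD0.
have gN n : N <= n -> good (run flip parities0 w n) (w n) i.
  by move=> /hN; rewrite /colors level_gt.
have wD1 n : N <= n -> D1 i (w n) by move=> /gN/orP[/D01//|/andP[]].
(* From [N] on all letters lie in [D1 i], which excludes [x i], so the parity is frozen. If it is
   odd, goodness forces [D0 i]; if even, the prefix of length [N] fits the first expression. *)
case qN: (run flip parities0 w N i); [right|left]; apply/catw_omegaE; exists N.
- split=> [|n le_n]; first exact/star_lettersE.
  have := gN n le_n; rewrite /good (@run_const _ N) ?qN ?andbF ?orbF //.
  by move=> m /wD1/neqx.
- by split=> [|n /wD1//]; apply/even_occE; rewrite -run_flip qN.
Qed.

Lemma family_chain_lang (w : nat -> S) :
  chain_lang family_lang w <-> even_parity (colors flip parities0 level w).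
Proof.
apply: chain_lang_parity => [n|i]; first exact: level_le.
exact: family_langE.
Qed.

Lemma card_parities : #|parities| = 2 ^ k.
Proof. by rewrite card_ffun card_bool card_ord. Qed.

Lemma family_dpa :
  exists2 A : dpa S, #|state A| = 2 ^ k & dpa_lang A = chain_lang family_lang.
Proof.
exists (dpa_of flip parities0 level); first exact: card_parities.
by apply/predeqP => w; rewrite dpa_of_langE family_chain_lang.
Qed.

Hypothesis x_inj : injective x.
Variable z : 'I_k -> S.
Hypothesis D1z : forall i, D1 i (z i).
Hypothesis D0z : forall i, ~~ D0 i (z i).

Lemma foldl_flip q u i : foldl flip q u i = q i (+) odd (count_mem (x i) u).
Proof.
elim: u q => [|y u IHu] q /=; first by rewrite addbF.
by rewrite IHu ffunE oddD oddb addbA.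
Qed.

Definition parity_word (t : parities) : seq S :=
  [seq x i | i <- enum 'I_k & t i].

Lemma foldl_parity_word t : foldl flip parities0 (parity_word t) = t.
Proof.
apply/ffunP => i; rewrite foldl_flip ffunE /= count_map count_filter.
rewrite (@eq_count _ _ (fun j => (j == i) && t i)) => [|j] /=; last first.
  by rewrite (inj_eq x_inj); case: eqVneq => [->|].
case ti: (t i).
  rewrite (@eq_count _ _ (pred1 i)) => [|j] /=; last by rewrite andbT.
  by rewrite count_uniq_mem ?enum_uniq // mem_enum.
by rewrite (@eq_count _ _ pred0) ?count_pred0 // => j /=; rewrite andbF.
Qed.

(** The prefix reaches the vector [t], and [z i] leaves it unchanged because no [x j] lies in
    [D1 i]. From there on the colour is constant. *)
Lemma family_lang_parity_word t i :
  chain_lang family_lang (word_app (parity_word t) (fun=> z i)) <->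
  ~~ odd (i + ~~ t i).
Proof.
rewrite family_chain_lang -(even_parity_shift _ (size (parity_word t))).
rewrite -(even_parity_liminf (liminf_cst (i + ~~ t i))).
set c := (X in even_parity X <-> _); suff -> : c = fun=> i + ~~ t i by [].
apply/funext => n; rewrite /c /colors run_word_app foldl_parity_word.
rewrite /word_app ltnNge leq_addr /=.
suff -> : run flip t (fun=> z i) n = t by apply: level_separating.
elim: n => //= n ->; apply/ffunP => j; rewrite ffunE.
rewrite (_ : (z i == x j) = false) ?addbF //; apply/negbTE.
by apply: contraTneq (D1z i) => ->.
Qed.

Lemma family_dpa_bound (A : dpa S) :
  dpa_lang A = chain_lang family_lang -> 2 ^ k <= #|state A|.
Proof.
move=> AE; rewrite -card_parities; apply: (nerode_bound (u := parity_word)).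
move=> s t /eqP ne_st; have [i ne_i] : exists i, s i != t i.
  apply: contrapT => eq_st; apply: ne_st; apply/ffunP => i.
  by apply/eqP; apply: contrapT => /negP ne_i; apply: eq_st; exists i.
exists (fun=> z i); rewrite AE !family_lang_parity_word !oddD.
case: (odd i) (s i) (t i) ne_i => -[] [] //= _ [h1 h2];
  by [have := h1 isT | have := h2 isT].
Qed.

End ParityFamily.

(** * Intersection of two chain languages *)

Lemma conj_chain_dpa (S : finType) (k : nat) (x y : 'I_k -> S)
    (D1 D0 E1 E0 : 'I_k -> pred S) :
    (forall i, subpred (D0 i) (D1 i)) ->
    (forall i j : 'I_k, i < j -> subpred (D1 j) (D0 i)) ->
    (forall i j, ~~ D1 i (x j)) ->
    (forall i, subpred (E0 i) (E1 i)) ->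
    (forall i j : 'I_k, i < j -> subpred (E1 j) (E0 i)) ->
    (forall i j, ~~ E1 i (y j)) ->
  exists2 A : dpa S, #|state A| = 2 ^ k * 2 ^ k * (2 * k) ^ (2 * k) &
    dpa_lang A = chain_lang (family_lang x D1 D0) `&`
                 chain_lang (family_lang y E1 E0).
Proof.
move=> D01 D10 D1x E01 E10 E1y.
pose step (q : parities k * parities k) a := (flip x q.1 a, flip y q.2 a).
pose q0 := (parities0 k, parities0 k).
pose c1 (q : parities k * parities k) := level D1 D0 q.1.
pose c2 (q : parities k * parities k) := level E1 E0 q.2.
have [q a|q a|A cardA langA] := @conj_parity_dpa _ _ step q0 c1 c2 k.
- exact: level_le.
- exact: level_le.
exists A; first by rewrite cardA card_prod card_parities.
apply/predeqP => w; rewrite langA.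
have runE n : run step q0 w n =
    (run (flip x) (parities0 k) w n, run (flip y) (parities0 k) w n).
  by elim: n => //= n ->.
have c1E : colors step q0 c1 w = colors (flip x) (parities0 k) (level D1 D0) w.
  by apply/funext => n; rewrite /colors /c1 runE.
have c2E : colors step q0 c2 w = colors (flip y) (parities0 k) (level E1 E0) w.
  by apply/funext => n; rewrite /colors /c2 runE.
by rewrite c1E c2E -!family_chain_lang.
Qed.

(** * The two concrete chains as instances *)

Definition a_between k (lo hi : nat) (y : letter k) : bool :=
  if y is inr j then lo <= j <= hi else false.

Lemma a_rangeE k lo hi :
  @a_range k lo hi = re_letters [set y | @a_between k lo hi y].
Proof.
congr re_letters; apply/predeqP => y; split=> [[j jr <-]|] //.
by case: y => // j jr; exists j.
Qed.

Definition evenX_letters k (i : 'I_k) : pred (letter k) :=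
  @a_between k 0 (4 * k - 2 * i.+1 + 1).
Definition anyX_letters k (i : 'I_k) : pred (letter k) :=
  @a_between k 0 (4 * k - 2 * i.+1).
Definition evenY_letters k (i : 'I_k) : pred (letter k) :=
  @a_between k (2 * i.+1 - 2) (4 * k - 1).
Definition anyY_letters k (i : 'I_k) : pred (letter k) :=
  @a_between k (2 * i.+1 - 1) (4 * k - 1).

Lemma LkE k :
  Lk k = chain_lang (family_lang (@letX k) (@evenX_letters k) (@anyX_letters k)).
Proof.
congr chain_lang; apply/funext => i.
by rewrite /Lki !a_rangeE.
Qed.

Lemma LhatkE k :
  Lhatk k = chain_lang (family_lang (@letY k) (@evenY_letters k) (@anyY_letters k)).
Proof.
congr chain_lang; apply/funext => i.
by rewrite /Lhatki !a_rangeE.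
Qed.

Theorem proposition5p13 (k : nat) :
  [/\ (exists2 A : dpa (letter k), #|state A| = 2 ^ k & dpa_lang A = Lk k)
        /\ (forall A : dpa (letter k), dpa_lang A = Lk k -> 2 ^ k <= #|state A|),
      (exists2 A : dpa (letter k), #|state A| = 2 ^ k & dpa_lang A = Lhatk k)
        /\ (forall A : dpa (letter k), dpa_lang A = Lhatk k -> 2 ^ k <= #|state A|)
    & exists2 A : dpa (letter k),
        #|state A| <= 2 ^ (4 * k ^ 2) * k ^ (2 * k) &
        dpa_lang A = Lk k `&` Lhatk k].
Proof.
have X01 (i : 'I_k) : subpred (anyX_letters i) (evenX_letters i).
  by move=> [//|j]; rewrite /anyX_letters /evenX_letters /=; lia.
have X10 (i j : 'I_k) : i < j -> subpred (evenX_letters j) (anyX_letters i).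
  move=> lt_ij [//|m]; rewrite /anyX_letters /evenX_letters /=.
  (* The bound on [j] keeps the natural subtractions from truncating. *)
  by have := ltn_ord j; lia.
have Y01 (i : 'I_k) : subpred (anyY_letters i) (evenY_letters i).
  by move=> [//|j]; rewrite /anyY_letters /evenY_letters /=; lia.
have Y10 (i j : 'I_k) : i < j -> subpred (evenY_letters j) (anyY_letters i).
  by move=> lt_ij [//|m]; rewrite /anyY_letters /evenY_letters /=; lia.
(* Indices of the separating letters: in each chain, the one letter allowed at even parity only. *)
have lt_x (i : 'I_k) : 4 * k - 2 * i.+1 + 1 < 4 * k by have := ltn_ord i; lia.
have lt_y (i : 'I_k) : 2 * i < 4 * k by have := ltn_ord i; lia.
rewrite LkE LhatkE; split.
- split=> [|A]; first exact: family_dpa.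
  apply: (@family_dpa_bound _ _ _ _ _ X01 X10 _ _
    (fun i => leta (Ordinal (lt_x i)))).
  + by [].
  + by move=> i j [].
  + by move=> i; rewrite /evenX_letters /=; lia.
  + by move=> i; rewrite /anyX_letters /=; lia.
- split=> [|A]; first exact: family_dpa.
  apply: (@family_dpa_bound _ _ _ _ _ Y01 Y10 _ _
    (fun i => leta (Ordinal (lt_y i)))).
  + by [].
  + by move=> i j [].
  + by move=> i; rewrite /evenY_letters /=; have := ltn_ord i; lia.
  + by move=> i; rewrite /anyY_letters /=; lia.
(* [a_between] computes to false on the X and Y letters, hence [isT]. *)
have [A cardA langA] := @conj_chain_dpa _ _ (@letX k) (@letY k) _ _ _ _
  X01 X10 (fun _ _ => isT) Y01 Y10 (fun _ _ => isT).
(* The powers of two combine to exponent [4 * k], and [k <= k ^ 2] for every natural [k], zero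
   included. *)
exists A => //; rewrite cardA expnMn mulnA -!expnD leq_mul2r.
by rewrite leq_pexp2l ?orbT //; nia.
Qed.
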